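(* For any graph $G$ on vertex set $[n]=\{1,\dots,n\}$, the design tubing complex of $G$ is isomorphic to the hypercube-graph tubing complex of $G^+$.
   Context: Design tubes: a round tube of $G$ is a nonempty subset of $[n]$ which induces a connected subgraph of $G$; a square tube is a single element of $[n]$ (regarded as distinct from the round tube on the same element). Both are called design tubes. Two design tubes $t_1,t_2$ are compatible if either (1) both are round, and $t_1\subset t_2$, $t_2\subset t_1$, or $t_1,t_2$ are disjoint and not adjacent; or (2) at least one of them is square, and they are disjoint. A design tubing is a set of pairwise compatible design tubes; design tubings form the design tubing complex. $G^+$ is the hypercube graph on $\pm[n]=\{-n,\dots,-1,1,\dots,n\}$ in which $\{i,j\}$ is an edge, for $i,j\in[n]$, if and only if it is an edge of $G$, and no edges are incident to negative vertices. For a hypercube graph $H$ on $\pm[n]$, a tube is a nonempty subset of $\pm[n]$ inducing a connected subgraph of $H$ and containing no pair $\{i,-i\}$. Two tubes are weakly compatible if one is contained in the other, or they are disjoint with no edge of $H$ between them. A tubing is a set of pairwise weakly compatible tubes whose union contains no pair $\{i,-i\}$; tubings form the hypercube-graph tubing complex. *)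

(* Defs.v *)
From mathcomp Require Import all_boot.

Set Implicit Arguments.
Unset Strict Implicit.
Unset Printing Implicit Defensive.

Record scomplex (V : finType) := SComplex {
  face : pred {set V};
  face_set1 : forall v, face [set v];
  face_sub : forall S T : {set V}, S \subset T -> face T -> face S
}.

Definition scomplex_iso (V W : finType) (K : scomplex V) (L : scomplex W) :=
  exists2 f : V -> W, bijective f &
    forall S : {set V}, face K S <-> face L (f @: S).

Record sgraph (V : finType) := SGraph {
  edge :> rel V;
  edge_sym : symmetric edge;
  edge_irr : irreflexive edge
}.

Section InducedSubgraphs.
Variables (V : finType) (G : sgraph V).

Definition induced (A : {set V}) : rel V :=
  [rel x y | [&& x \in A, y \in A & G x y]].

Definition connected_set (A : {set V}) :=
  (A != set0) && [forall x in A, forall y in A, connect (induced A) x y].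

Definition adjacent (A B : {set V}) :=
  [exists x in A, exists y in B, G x y].

(* This is at once compatibility of round tubes and weak compatibility of
   the tubes of a hypercube graph. *)
Definition weakly_compatible (A B : {set V}) :=
  [|| A \subset B, B \subset A | [disjoint A & B] && ~~ adjacent A B].

End InducedSubgraphs.

(* Only distinct members are compared: a square tube is not disjoint from
   itself. *)
Definition pairwise_distinct (T : finType) (r : rel T) (S : {set T}) :=
  [forall t1 in S, forall t2 in S, (t1 != t2) ==> r t1 t2].

Lemma pairwise_distinct_set1 (T : finType) (r : rel T) (t : T) :
  pairwise_distinct r [set t].
Proof.
apply/forall_inP => u /set1P ->; apply/forall_inP => v /set1P ->.
by rewrite eqxx.
Qed.

Lemma pairwise_distinct_sub (T : finType) (r : rel T) (S S' : {set T}) :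
  S \subset S' -> pairwise_distinct r S' -> pairwise_distinct r S.
Proof.
move=> /subsetP sSS' /forall_inP rS'; apply/forall_inP => t /sSS' /rS' rt.
by apply/forall_inP => u /sSS'; apply/forall_inP: u.
Qed.

Section DesignTubings.
(* The vertex set [n] is 'I_n. *)
Variables (n : nat) (G : sgraph 'I_n).

Definition round_tube := {A : {set 'I_n} | connected_set G A}.

(* [inl A] is the round tube A, and [inr i] the square tube on i. *)
Definition design_tube := (round_tube + 'I_n)%type.

Definition tube_support (t : design_tube) : {set 'I_n} :=
  match t with inl A => val A | inr i => [set i] end.

Definition design_compatible (t1 t2 : design_tube) : bool :=
  match t1, t2 with
  | inl A1, inl A2 => weakly_compatible G (val A1) (val A2)
  | _, _ => [disjoint tube_support t1 & tube_support t2]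
  end.

Definition design_tubing (S : {set design_tube}) :=
  pairwise_distinct design_compatible S.

Lemma design_tubing_sub (S T : {set design_tube}) :
  S \subset T -> design_tubing T -> design_tubing S.
Proof. exact: pairwise_distinct_sub. Qed.

Definition design_tubing_complex : scomplex design_tube :=
  SComplex (face := design_tubing)
           (pairwise_distinct_set1 design_compatible) design_tubing_sub.

End DesignTubings.

(* The vertex set of hypercube graphs, +/-[n]: [inl i] is the positive vertex
   i and [inr i] the negative vertex -i. *)
Definition signed (n : nat) := ('I_n + 'I_n)%type.

Section HypercubeTubings.
Variables (n : nat) (H : sgraph (signed n)).

Definition antipode_free (A : {set signed n}) :=
  [forall i : 'I_n, ~~ ((inl i \in A) && (inr i \in A))].

Definition hypercube_tube :=
  {A : {set signed n} | connected_set H A && antipode_free A}.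

Definition hypercube_tubing (S : {set hypercube_tube}) :=
  pairwise_distinct [rel A B | weakly_compatible H (val A) (val B)] S
  && antipode_free (\bigcup_(A in S) val A).

Lemma hypercube_tubing_set1 A : hypercube_tubing [set A].
Proof.
rewrite /hypercube_tubing pairwise_distinct_set1 big_set1 /=.
by have /andP[] := valP A.
Qed.

Lemma hypercube_tubing_sub (S T : {set hypercube_tube}) :
  S \subset T -> hypercube_tubing T -> hypercube_tubing S.
Proof.
move=> sST /andP[pT /forallP aT].
rewrite /hypercube_tubing (pairwise_distinct_sub sST pT) /=.
have /subsetP sU : \bigcup_(A in S) val A \subset \bigcup_(A in T) val A.
  by apply/bigcupsP => A /(subsetP sST) AT; apply: (bigcup_sup A).
apply/forallP => i; apply: contra (aT i) => /andP[pos neg].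
by rewrite !sU.
Qed.

Definition hypercube_tubing_complex : scomplex hypercube_tube :=
  SComplex hypercube_tubing_set1 hypercube_tubing_sub.

End HypercubeTubings.

Section Plus.
Variables (n : nat) (G : sgraph 'I_n).

Definition plus_edge : rel (signed n) := fun x y =>
  match x, y with inl i, inl j => G i j | _, _ => false end.

Lemma plus_edge_sym : symmetric plus_edge.
Proof. by move=> [i|i] [j|j] //=; apply: edge_sym. Qed.

Lemma plus_edge_irr : irreflexive plus_edge.
Proof. by move=> [i|i] //=; apply: edge_irr. Qed.

Definition plus_graph : sgraph (signed n) := SGraph plus_edge_sym plus_edge_irr.

End Plus.

(* Main.v *)
Require Import Defs.
From mathcomp Require Import all_boot.

(**
A negative vertex of [G^+] is isolated, so a tube of [G^+] is either a singleton
[{-i}] or a connected set of positive vertices. Sending a round tube to its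
positive copy and the square tube on [i] to [{-i}] is therefore a bijection on
tubes. A tube [{-i}] is weakly compatible with every tube of [G^+]; the
disjointness of round and square tubes is what the condition on the union of
a hypercube tubing encodes.
*)

Set Implicit Arguments.
Unset Strict Implicit.
Unset Printing Implicit Defensive.

Lemma homo_connect (V W : finType) (e : rel V) (e' : rel W) (f : V -> W) :
  {homo f : x y / e x y >-> e' x y} ->
  {homo f : x y / connect e x y >-> connect e' x y}.
Proof.
move=> fe x y /connectP[p ep ->]; apply/connectP.
by exists (map f p); rewrite ?last_map // (homo_path fe ep).
Qed.

(** A graph homomorphism on [A] carries each path inside [A] to a path inside the image. *)
Lemma connected_imset (V W : finType) (G : sgraph V) (H : sgraph W)
    (f : V -> W) (A : {set V}) :
  {in A &, {homo f : x y / G x y >-> H x y}} ->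
  connected_set G A -> connected_set H (f @: A).
Proof.
move=> fG /andP[A0 /forall_inP cA]; apply/andP; split.
  by rewrite imset_eq0.
apply/forall_inP=> _ /imsetP[x xA ->]; apply/forall_inP=> _ /imsetP[y yA ->].
have /forall_inP /(_ y yA) := cA x xA.
apply: homo_connect => {yA xA}x {}y /and3P[xA yA xy] /=.
by apply/and3P; split; [exact: imset_f | exact: imset_f | exact: fG].
Qed.

Lemma weakly_compatible_sym (V : finType) (K : sgraph V) :
  symmetric (weakly_compatible K).
Proof.
move=> A B; rewrite /weakly_compatible orbCA disjoint_sym.
congr [|| _, _ | _ && ~~ _].
by apply/exists_inP/exists_inP => -[x xA /exists_inP[y yB xy]];
   exists y => //; apply/exists_inP; exists x; rewrite // edge_sym.
Qed.

(** Injectivity is what matters: distinct members of [S] stay distinct, so exactly the same pairs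
    get compared. *)
Lemma pairwise_distinct_imset (T U : finType) (r : rel U) (f : T -> U)
    (S : {set T}) :
  injective f ->
  pairwise_distinct r (f @: S) = pairwise_distinct (relpre f r) S.
Proof.
move=> f_inj; apply/forall_inP/forall_inP => rS.
  move=> t tS; apply/forall_inP=> u uS; rewrite -(inj_eq f_inj).
  by have /forall_inP := rS _ (imset_f f tS); apply; apply: imset_f.
move=> _ /imsetP[t tS ->]; apply/forall_inP=> _ /imsetP[u uS ->].
by rewrite (inj_eq f_inj); have /forall_inP := rS t tS; apply.
Qed.

Section PlusTubes.
Variables (n : nat) (G : sgraph 'I_n).
Notation H := (plus_graph G).

Definition positive (A : {set 'I_n}) : {set signed n} := inl @: A.

Lemma inl_positive A i : (inl i \in positive A) = (i \in A).
Proof. exact: (mem_imset _ _ inl_inj). Qed.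

Lemma inr_positive A i : (inr i \in positive A) = false.
Proof. by apply/negP=> /imsetP[]. Qed.

Lemma connected_positive A : connected_set H (positive A) = connected_set G A.
Proof.
apply/idP/idP => [cA|]; last exact: connected_imset.
(* Forgetting signs maps edges of [H] to edges of [G], since edges of [H] join positive vertices
   only; it recovers [A] from its positive copy. *)
pose abs (x : signed n) := match x with inl i | inr i => i end.
have -> : A = abs @: positive A.
  by rewrite -imset_comp (eq_imset (g := id)) // imset_id.
by apply: connected_imset cA => -[i|i] [j|j].
Qed.

Lemma connected_negative i : connected_set H [set inr i].
Proof.
apply/andP; split; first by apply/set0Pn; exists (inr i); rewrite set11.
by apply/forall_inP=> _ /set1P->; apply/forall_inP=> _ /set1P->.
Qed.

Lemma connected_with_negative B i :
  connected_set H B -> inr i \in B -> B = [set inr i].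
Proof.
move=> /andP[_ /forall_inP cB] iB; apply/setP=> y; rewrite in_set1.
apply/idP/eqP=> [yB|->//].
have /forall_inP /(_ y yB) := cB _ iB.
(* The empty path gives [y = inr i]; a longer one would start with an edge at the isolated vertex
   [inr i]. *)
by case/connectP=> -[|z p] //= /andP[/and3P[]].
Qed.

Lemma connected_without_negative (B : {set signed n}) :
  (forall i, inr i \notin B) -> B = positive [set i | inl i \in B].
Proof.
move=> negB; apply/setP=> -[i|i]; first by rewrite inl_positive inE.
by rewrite inr_positive (negPf (negB i)).
Qed.

Lemma weakly_compatible_positive A B :
  weakly_compatible H (positive A) (positive B) = weakly_compatible G A B.
Proof.
have subP C D : (positive C \subset positive D) = (C \subset D).
  apply/idP/idP => [/subsetP sCD|]; last exact: imsetS.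
  by apply/subsetP=> i; rewrite -!inl_positive; apply: sCD.
rewrite /weakly_compatible !subP (imset_disjoint inl_inj).
congr [|| _, _ | _ && ~~ _].
apply/exists_inP/exists_inP => [[x /imsetP[i iA ->]]|[i iA]].
  case/exists_inP=> _ /imsetP[j jB ->] ij; exists i => //.
  by apply/exists_inP; exists j.
case/exists_inP=> j jB ij; exists (inl i); first exact: imset_f.
by apply/exists_inP; exists (inl j); first exact: imset_f.
Qed.

(** If [inr i] lies in [B], the singleton is contained in [B]; otherwise the two are disjoint, and
    no edge leaves [inr i]. *)
Lemma weakly_compatible_negative i B : weakly_compatible H [set inr i] B.
Proof.
rewrite /weakly_compatible sub1set disjoints1; case: (inr i \in B) => //=.
apply/orP; right; apply/exists_inP=> -[_ /set1P->].
by case/exists_inP.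
Qed.

Definition plus_set (t : design_tube G) : {set signed n} :=
  match t with inl A => positive (val A) | inr i => [set inr i] end.

Lemma plus_set_tube t :
  connected_set H (plus_set t) && antipode_free (plus_set t).
Proof.
case: t => [A|i] /=; apply/andP; split.
- by rewrite connected_positive (valP A).
- by apply/forallP=> i; rewrite inr_positive andbF.
- exact: connected_negative.
- by apply/forallP=> j; rewrite !in_set1.
Qed.

Definition plus_tube t : hypercube_tube H :=
  exist _ (plus_set t) (plus_set_tube t).

Lemma plus_tube_inj : injective plus_tube.
Proof.
move=> t u /(congr1 val) /=; case: t u => [A|i] [B|j] /= /setP AB.
- congr inl; apply/val_inj/setP=> i.
  by rewrite -[LHS]inl_positive AB inl_positive.
- by have := AB (inr j); rewrite inr_positive set11.
- by have := AB (inr i); rewrite inr_positive set11.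
- by have := AB (inr i); rewrite set11 => /esym/set1P[->].
Qed.

(** The boolean equality lets [xchoose] extract a preimage, which defines the inverse map. *)
Lemma plus_tube_surj B : exists t, plus_tube t == B.
Proof.
have /andP[cB _] := valP B.
have [/existsP[i iB]|/existsPn negB] := boolP [exists i, inr i \in val B].
  by exists (inr i); rewrite -val_eqE /= -(connected_with_negative cB iB).
have eqB := connected_without_negative negB.
have cA : connected_set G [set i | inl i \in val B].
  by rewrite -connected_positive -eqB.
by exists (inl (Sub _ cA : round_tube G)); rewrite -val_eqE /= -eqB.
Qed.

Lemma plus_tube_bij : bijective plus_tube.
Proof.
have fK : cancel (fun B => xchoose (plus_tube_surj B)) plus_tube.
  by move=> B; apply/eqP/(xchooseP (plus_tube_surj B)).
exists (fun B => xchoose (plus_tube_surj B)) => //.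
exact: inj_can_sym fK plus_tube_inj.
Qed.

Lemma weakly_compatible_plus_set t u :
  weakly_compatible H (plus_set t) (plus_set u) =
  match t, u with inl A, inl B => weakly_compatible G (val A) (val B)
                | _, _ => true end.
Proof.
case: t u => [A|i] [B|j] /=; first exact: weakly_compatible_positive.
- by rewrite weakly_compatible_sym weakly_compatible_negative.
- exact: weakly_compatible_negative.
- exact: weakly_compatible_negative.
Qed.

(** In the union, a positive vertex can come only from a round tube and a negative one only from a
    square tube, so an antipodal pair is exactly a square tube on an element of a round tube. *)
Lemma antipode_free_plus_set (S : {set design_tube G}) :
  reflect (forall A i, inl A \in S -> inr i \in S -> i \notin val A)
          (antipode_free (\bigcup_(t in S) plus_set t)).
Proof.
apply: (iffP forallP) => [freeS A i AS iS|freeS i].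
  apply: contra (freeS i) => iA; apply/andP; split; apply/bigcupP.
    by exists (inl A) => //=; rewrite inl_positive.
  by exists (inr i) => //=; rewrite set11.
apply/andP=> -[/bigcupP[[A|k] tS /=]]; last by rewrite in_set1.
rewrite inl_positive => iA /bigcupP[[B|j] uS /=]; first by rewrite inr_positive.
by case/set1P=> eq_ij; have := freeS A i tS; rewrite iA eq_ij => /(_ uS).
Qed.

(** The three kinds of pairs are handled separately: two round tubes by weak compatibility, a round
    and a square one by the condition on the union, two square ones by being distinct. *)
Lemma plus_tubing (S : {set design_tube G}) :
  design_tubing S = hypercube_tubing (plus_tube @: S).
Proof.
rewrite /hypercube_tubing big_imset /=; last first.
  by move=> t u _ _; apply: plus_tube_inj.
rewrite (pairwise_distinct_imset _ _ plus_tube_inj).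
apply/idP/andP => [/forall_inP dS|].
  split.
    apply/forall_inP=> t tS; apply/forall_inP=> u uS; apply/implyP=> tu.
    have /forall_inP /(_ u uS) /implyP /(_ tu) := dS t tS.
    rewrite /= weakly_compatible_plus_set.
    by case: t u {tS uS tu} => [A|i] [B|j].
  apply/antipode_free_plus_set=> A i AS iS.
  by have /forall_inP /(_ _ iS) /= := dS _ AS; rewrite disjoint_sym disjoints1.
case=> [/forall_inP dS /antipode_free_plus_set freeS].
apply/forall_inP=> t tS; apply/forall_inP=> u uS; apply/implyP=> tu.
have /forall_inP /(_ u uS) /implyP /(_ tu) := dS t tS.
rewrite /= weakly_compatible_plus_set.
case: t u tS uS tu => [A|i] [B|j] //= tS uS tu _.
- by rewrite disjoint_sym disjoints1 freeS.
- by rewrite disjoints1 freeS.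
(* Distinct square tubes sit on distinct elements, hence are disjoint. *)
- by rewrite disjoints1 in_set1; apply: contra tu => /eqP->.
Qed.

End PlusTubes.

Theorem proposition6p1p2 (n : nat) (G : sgraph 'I_n) :
  scomplex_iso (design_tubing_complex G)
               (hypercube_tubing_complex (plus_graph G)).
Proof.
exists (@plus_tube n G); first exact: plus_tube_bij.
by move=> S /=; rewrite plus_tubing.
Qed.
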